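(* For all $u\in\mathcal{D}$, we have $$\text{(I)}\quad \delta(u)\ge(\mu_2-\mu_1)\,d_2(u,\mathcal{M}_1)^2\qquad\text{and}\qquad \text{(II)}\quad \delta(u)\ge\left(1-\frac{\mu_1}{\mu_2}\right)d_{\mathcal{E}}(u,\mathcal{M}_1)^2.$$ The constants $\mu_2-\mu_1$ and $1-\mu_1/\mu_2$ are sharp (cannot be replaced by larger constants) and can be attained (equality holds for some $u$ with nonzero distance to $\mathcal{M}_1$), and equality holds in (I), respectively in (II), if and only if $u\in\mathcal{M}_2$. More precisely, for all $u\in\mathcal{D}$, $$\delta(u)-(\mu_2-\mu_1)\,d_2(u,\mathcal{M}_1)^2=\sum_{k\ge3}(\mu_k-\mu_2)\|u_k\|_2^2,$$ $$\delta(u)-\left(1-\frac{\mu_1}{\mu_2}\right)d_{\mathcal{E}}(u,\mathcal{M}_1)^2=\frac{\mu_1}{\mu_2}\sum_{k\ge3}(\mu_k-\mu_2)\|u_k\|_2^2.$$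
   Context: $\mu$ is a finite positive measure on a set $X$ and $A\ge0$ is a self-adjoint operator on $L^2(\mu)$ with compact resolvent. Its distinct eigenvalues are $0=\mu_0<\mu_1<\mu_2<\cdots$ with $\mu_k\to\infty$; $E_k$ is the (finite-dimensional) eigenspace of $\mu_k$, and $E_0$ is assumed to be the space of constant functions. $\mathcal{E}(u)=\langle Au,u\rangle$ is the associated quadratic form, defined on its form domain $\mathcal{D}$. $\|\cdot\|_2$ is the norm of $L^2(\mu)$. For $u\in\mathcal{D}$, $\bar u$ is the orthogonal projection of $u$ onto $E_0$, $\operatorname{Var}_\mu(u)=\|u-\bar u\|_2^2$, and $u-\bar u=\sum_{k\ge1}u_k$ with $u_k\in E_k$ the orthogonal projection of $u$ onto $E_k$. Set $$\delta(u)=\mathcal{E}(u)-\mu_1\operatorname{Var}_\mu(u),\qquad \mathcal{M}_m=E_0\oplus E_1\oplus\cdots\oplus E_m,$$ $$d_2(u,\mathcal{M}_m)^2=\inf_{\Phi\in\mathcal{M}_m}\|u-\Phi\|_2^2,\qquad d_{\mathcal{E}}(u,\mathcal{M}_m)^2=\inf_{\Phi\in\mathcal{M}_m}\mathcal{E}(u-\Phi).$$ *)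

(* Defs.v *)
From HB Require Import structures.
From mathcomp Require Import all_boot all_order all_algebra.
From mathcomp Require Import all_classical all_reals all_analysis.
From mathcomp Require Import measurable_realfun.

Set Implicit Arguments.
Unset Strict Implicit.
Unset Printing Implicit Defensive.

Import Order.TTheory GRing.Theory Num.Theory.
Import numFieldNormedType.Exports.

Local Open Scope classical_set_scope.
Local Open Scope ring_scope.
Local Open Scope quotient_scope.

(* The library provides [LspaceType2 mu], the a.e.-classes of real-valued
   square-integrable functions, without algebraic structure. [L2 mu] is this
   type with its normed-space structure over R. *)
Section L2_space.
Context d (T : measurableType d) (R : realType) (mu : {measure set T -> \bar R}).

Definition L2 : Type := LspaceType2 mu.

Local Notation Lf := (LfunType mu (lee1n 2)).

Lemma L2_Lfun_subproof (u : L2) :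
  (repr (LebesgueSpace.sort u) : T -> R) \in Lfun mu 2%:E.
Proof.
rewrite inE; apply/andP; split; rewrite inE /=.
  exact: (@measurable_funPT _ _ T (measurableTypeR R)).
by exact: (@Lebesgue_finite _ _ _ _ _ _ u).
Qed.

Definition L2_fun (u : L2) : Lf := Lfun_Sub (lee1n 2) (L2_Lfun_subproof u).

Lemma finite_norm_ae (f g : {mfun T >-> measurableTypeR R}) :
  f = g %[ae mu] -> finite_norm mu 2%:E f -> finite_norm mu 2%:E g.
Proof.
move=> fg; rewrite /finite_norm unlock /=; apply: le_lt_trans.
rewrite le_eqVlt; apply/orP; left; apply/eqP; congr (_ `^ _)%E.
apply: ae_eq_integral => //.
- apply/measurable_EFinP.
  apply: (@measurableT_comp _ _ _ _ _ _ (@powR R ^~ _)) => //.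
  exact: measurableT_comp.
- apply/measurable_EFinP.
  apply: (@measurableT_comp _ _ _ _ _ _ (@powR R ^~ _)) => //.
  exact: measurableT_comp.
by apply: filterS fg => x + _ => /(_ I) /= ->.
Qed.

Lemma Lf_mfun_subproof (f : Lf) :
  measurable_fun setT (f : T -> measurableTypeR R).
Proof. exact: (@measurable_funPT _ _ T R f). Qed.

(* The quotient underlying [LspaceType] uses the measurable type
   [measurableTypeR R], whose display differs from that of [R]. *)
Definition Lf_mfun (f : Lf) : {mfun T >-> measurableTypeR R} :=
  MeasurableFun.Pack (MeasurableFun.Class
    (isMeasurableFun.Build _ _ T (measurableTypeR R) f (Lf_mfun_subproof f))).

Definition Lf_pi (f : Lf) : {mfun_ mu, T >-> measurableTypeR R} :=
  \pi_({mfun_ mu, T >-> measurableTypeR R}) (Lf_mfun f).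

Lemma Lf_piP (f g : Lf) : Lf_pi f = Lf_pi g <-> f = g %[ae mu].
Proof.
by rewrite (rwP eqP) /Lf_pi eqmodE; split=> [/asboolP|fg] //; exact/asboolP.
Qed.

Lemma Lf_pi_finite (f : Lf) : finite_norm mu 2%:E (Lf_pi f).
Proof.
apply: (@finite_norm_ae (Lf_mfun f)); last exact: Lfunction_finite.
apply/asboolP; rewrite -[asbool _]/(ae_eq_op mu (Lf_mfun f) (repr (Lf_pi f))).
by rewrite -eqmodE reprK.
Qed.

Definition L2_class (f : Lf) : L2 :=
  LebesgueSpace.Pack (LebesgueSpace.Class
    (@isFinLebesgue.Build _ _ _ _ _ (lee1n 2) _ (Lf_pi_finite f))).

Lemma L2_inj (u v : L2) : LebesgueSpace.sort u = LebesgueSpace.sort v -> u = v.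
Proof.
case: u v => [u [[pu]]] [v [[pv]]] /= uv; rewrite uv in pu *.
by rewrite (Prop_irrelevance pu pv).
Qed.

Lemma L2_classP (f g : Lf) : L2_class f = L2_class g <-> f = g %[ae mu].
Proof.
split=> [fg|/Lf_piP fg]; last exact: L2_inj.
by apply/Lf_piP; rewrite -[LHS]/(LebesgueSpace.sort (L2_class f)) fg.
Qed.

Lemma L2_funK (u : L2) : L2_class (L2_fun u) = u.
Proof.
apply: L2_inj; rewrite -[RHS]reprK /=.
by apply/eqP; rewrite eqmodE; apply/asboolP; exact: ae_eq_refl.
Qed.

Lemma L2_classK (f : Lf) : L2_fun (L2_class f) = f %[ae mu].
Proof. by apply/L2_classP; rewrite L2_funK. Qed.

HB.instance Definition _ := gen_eqMixin L2.
HB.instance Definition _ := gen_choiceMixin L2.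

Let L2_add (u v : L2) : L2 := L2_class (L2_fun u + L2_fun v).
Let L2_opp (u : L2) : L2 := L2_class (- L2_fun u).
Let L2_scale (a : R) (u : L2) : L2 := L2_class (a *: L2_fun u).

Let L2_classD f g : L2_add (L2_class f) (L2_class g) = L2_class (f + g).
Proof.
apply/L2_classP; move: (L2_classK f) (L2_classK g).
apply: filterS2 => x /(_ I) fx /(_ I) gx _; exact: (f_equal2 +%R fx gx).
Qed.

Let L2_classN f : L2_opp (L2_class f) = L2_class (- f).
Proof.
apply/L2_classP; move: (L2_classK f).
apply: filterS => x /(_ I) fx _; exact: (f_equal -%R fx).
Qed.

Let L2_classZ a f : L2_scale a (L2_class f) = L2_class (a *: f).
Proof.
apply/L2_classP; move: (L2_classK f).
apply: filterS => x /(_ I) fx _; exact: (f_equal ( *%R a) fx).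
Qed.

Let L2_addA : associative L2_add.
Proof.
move=> u v w; rewrite -(L2_funK u) -(L2_funK v) -(L2_funK w).
by rewrite !L2_classD addrA.
Qed.

Let L2_addC : commutative L2_add.
Proof.
by move=> u v; rewrite -(L2_funK u) -(L2_funK v) !L2_classD addrC.
Qed.

Let L2_add0 : left_id (L2_class 0) L2_add.
Proof. by move=> u; rewrite -(L2_funK u) L2_classD add0r. Qed.

Let L2_addN : left_inverse (L2_class 0) L2_opp L2_add.
Proof. by move=> u; rewrite -(L2_funK u) L2_classN L2_classD addNr. Qed.

HB.instance Definition _ :=
  GRing.isZmodule.Build L2 L2_addA L2_addC L2_add0 L2_addN.

Let L2_scaleA a b (v : L2) : L2_scale a (L2_scale b v) = L2_scale (a * b) v.
Proof. by rewrite -(L2_funK v) !L2_classZ scalerA. Qed.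

Let L2_scale1 : left_id 1 L2_scale.
Proof. by move=> v; rewrite -(L2_funK v) L2_classZ scale1r. Qed.

Let L2_scaleDr : right_distributive L2_scale +%R.
Proof.
move=> a u v; rewrite -(L2_funK u) -(L2_funK v).
rewrite -[_ + _]/(L2_add _ _) -[RHS]/(L2_add _ _).
by rewrite !(L2_classD, L2_classZ) scalerDr.
Qed.

Let L2_scaleDl v : {morph L2_scale^~ v : a b / a + b}.
Proof.
move=> a b; rewrite -(L2_funK v) -[RHS]/(L2_add _ _).
by rewrite !(L2_classD, L2_classZ) scalerDl.
Qed.

HB.instance Definition _ := GRing.Zmodule_isLmodule.Build R L2
  L2_scaleA L2_scale1 L2_scaleDr L2_scaleDl.

Lemma L2_class_is_linear : linear (L2_class : Lf -> L2).
Proof.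
by move=> a f g; rewrite -L2_classD -L2_classZ.
Qed.

HB.instance Definition _ := GRing.isLinear.Build R Lf L2 *:%R L2_class
  L2_class_is_linear.

Let L2_norm (u : L2) : R := fine ('N[mu]_2%:E[EFin \o L2_fun u])%E.

Let L2_norm_class (f : Lf) :
  L2_norm (L2_class f) = fine ('N[mu]_2%:E[EFin \o f])%E.
Proof.
rewrite /L2_norm unlock /=; congr (fine (_ `^ _)%E).
apply: ae_eq_integral => //.
- apply/measurable_EFinP.
  apply: (@measurableT_comp _ _ _ _ _ _ (@powR R ^~ _)) => //.
  exact: measurableT_comp.
- apply/measurable_EFinP.
  apply: (@measurableT_comp _ _ _ _ _ _ (@powR R ^~ _)) => //.
  exact: measurableT_comp.
by apply: filterS (L2_classK f) => x + _ => /(_ I) /= ->.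
Qed.

Let L2_ler_normD u v : L2_norm (u + v) <= L2_norm u + L2_norm v.
Proof.
rewrite -(L2_funK u) -(L2_funK v) -linearD !L2_norm_class.
exact: ler_LnormD.
Qed.

Let L2_normrZ a u : L2_norm (a *: u) = `|a| * L2_norm u.
Proof.
rewrite -(L2_funK u) -linearZ !L2_norm_class.
apply: EFin_inj; rewrite EFinM !finite_norm_fine.
exact: LnormZ.
Qed.

Let L2_normr0_eq0 u : L2_norm u = 0 -> u = 0.
Proof.
move=> u0; rewrite -(L2_funK u) -(linear0 L2_class).
by apply/L2_classP; exact: fine_Lnormr_eq0.
Qed.

HB.instance Definition _ := Lmodule_isNormed.Build R L2
  L2_ler_normD L2_normrZ L2_normr0_eq0.

Lemma L2_normE (u : L2) : `|u| = fine ('N[mu]_2%:E[EFin \o L2_fun u])%E.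
Proof. by []. Qed.

End L2_space.

Section L2_inner_product.
Context d (T : measurableType d) (R : realType) (mu : {measure set T -> \bar R}).
Implicit Types u v w : L2 mu.

Definition dot u v : R := \int[mu]_x (L2_fun u x * L2_fun v x).

Lemma dotC u v : dot u v = dot v u.
Proof. by apply: eq_Rintegral => x _; rewrite mulrC. Qed.

Lemma dot_integrable u v :
  mu.-integrable setT (EFin \o (L2_fun u \* L2_fun v)).
Proof.
by apply/Lfun1_integrable; apply: Lfun2_mul_Lfun1; exact: LfunP.
Qed.

Lemma dot_class (f g : LfunType mu (lee1n 2)) :
  dot (L2_class f) (L2_class g) = \int[mu]_x (f x * g x).
Proof.
rewrite /dot /Rintegral; congr fine; apply: ae_eq_integral => //.
- exact: measurable_int (dot_integrable _ _).
- by apply/measurable_EFinP; exact: measurable_funM.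
move: (L2_classK f) (L2_classK g).
apply: filterS2 => x /(_ I) fx /(_ I) gx _; congr EFin.
exact: (f_equal2 *%R fx gx).
Qed.

Lemma dotDl u v w : dot (u + v) w = dot u w + dot v w.
Proof.
rewrite -(L2_funK u) -(L2_funK v) -(L2_funK w) -linearD !dot_class.
rewrite -RintegralD//; try exact: dot_integrable.
by apply: eq_Rintegral => x _; rewrite -mulrDl.
Qed.

Lemma dotZl a u v : dot (a *: u) v = a * dot u v.
Proof.
rewrite -(L2_funK u) -(L2_funK v) -linearZ !dot_class.
rewrite -RintegralZl//; last exact: dot_integrable.
by apply: eq_Rintegral => x _; rewrite mulrA.
Qed.

Lemma dotuu u : dot u u = `|u| ^+ 2.
Proof.
rewrite -powR_mulrn// L2_normE -fine_poweR powR_Lnorm//.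
rewrite /dot /Rintegral; congr fine; apply: eq_integral => x _ /=.
by rewrite powR_mulrn// real_normK ?num_real// -expr2.
Qed.

End L2_inner_product.

Section unbounded_operators.
Context d (T : measurableType d) (R : realType) (mu : {measure set T -> \bar R}).
Local Notation H := (L2 mu).

(* A linear operator defined on a linear subspace of L2; the values of [op_fun]
   outside [op_dom] carry no meaning. *)
Record operator := Operator {
  op_dom : set H;
  op_fun :> H -> H;
  op_dom0 : op_dom 0;
  op_domP : forall a u v, op_dom u -> op_dom v -> op_dom (a *: u + v);
  op_linear : forall a u v, op_dom u -> op_dom v ->
    op_fun (a *: u + v) = a *: op_fun u + op_fun v
}.

Implicit Types (A : operator) (u v : H).

Definition graph A : set (H * H) := [set p | op_dom A p.1 /\ A p.1 = p.2].

Definition adjoint_graph A : set (H * H) :=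
  [set p | forall u, op_dom A u -> dot (A u) p.1 = dot u p.2].

Definition self_adjoint A := dense (op_dom A) /\ adjoint_graph A = graph A.

Definition nonnegative A := forall u, op_dom A u -> 0 <= dot (A u) u.

Definition is_resolvent A (z : R) (B : {linear H -> H}) :=
  [/\ continuous B,
      forall v, op_dom A (B v) /\ A (B v) - z *: B v = v &
      forall u, op_dom A u -> B (A u - z *: u) = u].

Definition compact_operator (B : H -> H) :=
  precompact (B @` [set u | `|u| <= 1]).

Definition has_compact_resolvent A :=
  exists z (B : {linear H -> H}), is_resolvent A z B /\ compact_operator B.

Definition eigspace A (l : R) : set H := [set u | op_dom A u /\ A u = l *: u].

Definition eigvalue A (l : R) := exists2 u, eigspace A l u & u != 0.

(* The form domain is the domain of the closure of [u |-> <A u, u>]: limits in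
   L2 of sequences of [op_dom A] that are Cauchy for the form. The form takes at
   such a limit the limit of its values; for a nonnegative self-adjoint [A] this
   does not depend on the sequence. *)
Definition form_approx A (s : nat -> H) u :=
  [/\ forall n, op_dom A (s n),
      s @ \oo --> u &
      forall e : R, 0 < e -> exists N, forall m n, (N <= m)%N -> (N <= n)%N ->
        dot (A (s m - s n)) (s m - s n) < e].

Definition form_dom A : set H := [set u | exists s, form_approx A s u].

Definition form A u : R :=
  xget 0 [set e | exists2 s, form_approx A s u &
                  dot (A (s n)) (s n) @[n --> \oo] --> e].

(* Meaningful when [u] has an orthogonal projection onto [F]. *)
Definition oproj (F : set H) u : H :=
  xget 0 [set v | F v /\ forall w, F w -> dot (u - v) w = 0].

Definition variance A u : R := `|u - oproj (eigspace A 0) u| ^+ 2.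

Definition eigsum A (lam : nat -> R) (m : nat) : set H :=
  [set u | exists2 v : nat -> H,
    (forall k, (k <= m)%N -> eigspace A (lam k) (v k)) &
    u = \sum_(k < m.+1) v k].

Definition deficit A (lam : nat -> R) u : R := form A u - lam 1%N * variance A u.

Definition dist2_sq (F : set H) u : R := inf [set `|u - w| ^+ 2 | w in F].

Definition distE_sq A (F : set H) u : R := inf [set form A (u - w) | w in F].

End unbounded_operators.

(* Main.v *)
Require Import Defs.
From mathcomp Require Import all_boot all_order all_algebra.
From mathcomp Require Import all_classical all_reals all_analysis.
From mathcomp Require Import ring lra.

Set Implicit Arguments.
Unset Strict Implicit.
Unset Printing Implicit Defensive.

Import Order.TTheory GRing.Theory Num.Theory.
Import numFieldNormedType.Exports.

Local Open Scope classical_set_scope.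
Local Open Scope ring_scope.

(** The operator [A] is diagonalized by its eigenspaces [E k], and every quantity
    in the theorem becomes a series in the squared norms [a k] of the components
    [eigproj k u]: for [u] in the form domain, the form is
    [sum_k lam k * a k], the squared norm is [sum_k a k], and the squared
    distances to [E 0 + E 1] are the same two series restricted to [k >= 2]
    ([form_cvg], [parseval], [distE_eigsum], [dist2_eigsum]). The deficit is
    [sum_(k >= 1) (lam k - lam 1) * a k], and subtracting the multiple of the
    distance that cancels the term [k = 2] leaves a multiple of the series [excess]
    of the [(lam k - lam 2) * a k] for [k >= 3]. Its terms are nonnegative, and they
    all vanish exactly when [a k = 0] for [k >= 3], that is on [E 0 + E 1 + E 2].
    An eigenvector for [lam 2] has no excess and gives sharpness.

    The substance is the expansion itself. Let [B] be a compact resolvent of [A],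
    at [z]. It is symmetric, and it maps the orthogonal complement [F] of
    [E 0 + ... + E n] into itself. The norm of [B] on [F] is attained at an
    eigenvector ([norm_attained]), which is an eigenvector of [A] orthogonal to
    [E 0], ..., [E n], so that this norm is at most [(lam n.+1 - z)^-1] as soon as
    [z < lam n.+1] ([resolvent_tail]). Since [lam] tends to infinity and the domain
    of [A] is the range of [B], partial expansions converge on the domain
    ([eigpart_cvg_dom]), and so do the partial sums of the form
    ([eigform_cvg_dom]). A uniform tail estimate ([eigform_tail_le]) carries both
    over to the form domain. *)

(** * Geometry of the inner product *)
Section Dot.
Context d (X : measurableType d) (R : realType) (mu : {measure set X -> \bar R}).
Local Notation H := (L2 mu).
Implicit Types (u v w : H) (s : nat -> H) (a : R).

Lemma dotDr u v w : dot u (v + w) = dot u v + dot u w.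
Proof. by rewrite dotC dotDl !(dotC u). Qed.

Lemma dotZr a u v : dot u (a *: v) = a * dot u v.
Proof. by rewrite dotC dotZl dotC. Qed.

Lemma dotNl u v : dot (- u) v = - dot u v.
Proof. by rewrite -scaleN1r dotZl mulN1r. Qed.

Lemma dotNr u v : dot u (- v) = - dot u v.
Proof. by rewrite dotC dotNl dotC. Qed.

Lemma dotBl u v w : dot (u - v) w = dot u w - dot v w.
Proof. by rewrite dotDl dotNl. Qed.

Lemma dotBr u v w : dot u (v - w) = dot u v - dot u w.
Proof. by rewrite dotDr dotNr. Qed.

Lemma dot0l u : dot 0 u = 0.
Proof. by rewrite -(scale0r 0) dotZl mul0r. Qed.

Lemma dot0r u : dot u 0 = 0.
Proof. by rewrite dotC dot0l. Qed.

Lemma dot_suml (I : Type) (r : seq I) (P : pred I) (F : I -> H) v :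
  dot (\sum_(i <- r | P i) F i) v = \sum_(i <- r | P i) dot (F i) v.
Proof.
by apply: (big_morph (fun u => dot u v)); [move=> u w; exact: dotDl|exact: dot0l].
Qed.

Lemma normB_sqr u v : `|u - v| ^+ 2 = `|u| ^+ 2 - 2 * dot u v + `|v| ^+ 2.
Proof. by rewrite -!dotuu dotBl !dotBr (dotC v u); ring. Qed.

Lemma normD_sqr_orth u v : dot u v = 0 -> `|u + v| ^+ 2 = `|u| ^+ 2 + `|v| ^+ 2.
Proof. by move=> uv; rewrite -!dotuu dotDl !dotDr (dotC v u) uv; ring. Qed.

Lemma norm_sqr_eq0 u : (`|u| ^+ 2 == 0) = (u == 0).
Proof. by rewrite expf_eq0 /= normr_eq0. Qed.

Lemma cauchy_schwarz u v : `|dot u v| <= `|u| * `|v|.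
Proof.
have [->|v0] := eqVneq v 0; first by rewrite dot0r !normr0 mulr0.
have v2 : 0 < `|v| ^+ 2 by rewrite exprn_gt0// normr_gt0.
rewrite -(ler_pXn2r (n := 2))// ?nnegrE ?mulr_ge0// exprMn real_normK ?num_real//.
(* [|v|^2 u] minus its component along [v] has a nonnegative squared norm. *)
have : 0 <= `|(`|v| ^+ 2) *: u - dot u v *: v| ^+ 2 by exact: exprn_ge0.
rewrite normB_sqr dotZl dotZr !normrZ !exprMn !real_normK ?num_real//.
move=> h; rewrite -subr_ge0 -(pmulr_rge0 _ v2); apply: le_trans h _.
by rewrite le_eqVlt; apply/orP; left; apply/eqP; ring.
Qed.

Lemma cvg_norm_sqr s u : s @ \oo --> u -> `|s n| ^+ 2 @[n --> \oo] --> `|u| ^+ 2.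
Proof.
move=> su; rewrite expr2; under eq_fun do rewrite expr2.
by apply: cvgM; exact: cvg_norm.
Qed.

Lemma cvg_dotl s u v : s @ \oo --> u -> dot (s n) v @[n --> \oo] --> dot u v.
Proof.
move=> su.
have E w : dot w v = 2^-1 * (`|w| ^+ 2 + `|v| ^+ 2 - `|w - v| ^+ 2).
  by rewrite normB_sqr; field.
rewrite E; under eq_fun do rewrite E.
apply: cvgM; first exact: cvg_cst.
apply: cvgB; last by apply: cvg_norm_sqr; apply: cvgB => //; exact: cvg_cst.
by apply: cvgD; [exact: cvg_norm_sqr|exact: cvg_cst].
Qed.

Lemma norm_sqr_cvg0 s : `|s n| ^+ 2 @[n --> \oo] --> (0 : R) -> s @ \oo --> 0.
Proof.
move=> s0; apply/norm_cvg0P.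
have -> : (fun n => `|s n|) = (fun n => Num.sqrt (`|s n| ^+ 2)).
  by apply/funext => n; rewrite sqrtr_sqr normr_id.
by rewrite -sqrtr0; apply: continuous_cvg => //; exact: sqrt_continuous.
Qed.

(** * Orthogonal projections *)

Definition subspace (F : set H) := F 0 /\ forall a u v, F u -> F v -> F (a *: u + v).

Definition is_oproj (F : set H) u v := F v /\ forall w, F w -> dot (u - v) w = 0.

Lemma subspaceZ F a u : subspace F -> F u -> F (a *: u).
Proof. by move=> [F0 FP] Fu; rewrite -(addr0 (a *: u)); exact: FP. Qed.

Lemma subspaceD F u v : subspace F -> F u -> F v -> F (u + v).
Proof. by move=> [F0 FP] Fu Fv; rewrite -(scale1r u); exact: FP. Qed.

Lemma subspaceB F u v : subspace F -> F u -> F v -> F (u - v).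
Proof. by move=> [F0 FP] Fu Fv; rewrite addrC -scaleN1r; exact: FP. Qed.

Lemma oproj_eq F u v : subspace F -> is_oproj F u v -> oproj F u = v.
Proof.
move=> FS [Fv uv]; apply: xget_unique => // w [Fw uw].
have Fvw : F (w - v) by exact: subspaceB.
apply/eqP; rewrite -subr_eq0 -norm_sqr_eq0 -dotuu.
have -> : dot (w - v) (w - v) = dot (u - v) (w - v) - dot (u - w) (w - v).
  by rewrite -dotBl; congr dot; rewrite opprB [RHS]addrC addrA subrK.
by rewrite uv// uw// subr0.
Qed.

(** A minimizing sequence for the distance from [u] to [F] is bounded, and any of
    its limit points realizes the distance, hence is the projection. *)
Lemma oproj_exists F u : subspace F ->
  (forall s, (forall n, F (s n)) -> (exists M, forall n, `|s n| <= M) ->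
    exists f : nat -> nat, exists y,
      [/\ f @ \oo --> \oo, F y & s \o f @ \oo --> y]) ->
  is_oproj F u (oproj F u).
Proof.
move=> FS Fcpt; suff [v uv] : exists v, is_oproj F u v by rewrite (oproj_eq FS uv).
pose S := [set `|u - w| ^+ 2 | w in F]; pose m := inf S.
have Slb : has_inf S.
  split; first by exists (`|u - 0| ^+ 2), 0 => //; case: FS.
  by exists 0 => _ [w _ <-]; exact: exprn_ge0.
have /choice[s hs] (n : nat) : exists w, F w /\ `|u - w| ^+ 2 < m + n.+1%:R^-1.
  have [|_ [w Fw <-] ?] := @inf_adherent _ S n.+1%:R^-1 _ Slb; first by [].
  by exists w.
have [||f [y [ff Fy sy]]] := Fcpt s.
- by move=> n; case: (hs n).
- exists (`|u| + (m + 2) / 2) => n; have [_ {}hs] := hs n.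
  have us : `|u - s n| <= (m + 2) / 2.
    have {}hs : `|u - s n| ^+ 2 <= m + 1.
      by apply: (le_trans (ltW hs)); rewrite lerD2l invf_le1// ler1n.
    by have := sqr_ge0 (`|u - s n| - 1); lra.
  by rewrite -[s n](subKr u); apply: le_trans (ler_normB _ _) _; rewrite lerD2l.
exists y; split=> // w Fw.
have uym : `|u - y| ^+ 2 = m.
  have uy : `|u - s (f n)| ^+ 2 @[n --> \oo] --> `|u - y| ^+ 2.
    by apply: cvg_norm_sqr; apply: cvgB => //; exact: cvg_cst.
  apply/eqP; rewrite eq_le; apply/andP; split; last first.
    by apply: ge_inf; [case: Slb|exists y].
  have um : m + (f n).+1%:R^-1 @[n --> \oo] --> m + 0.
    apply: cvgD; first exact: cvg_cst.
    exact: (@cvg_comp _ _ _ f (@harmonic R) _ _ _ ff (@cvg_harmonic R)).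
  rewrite -[leRHS]addr0; apply: (ler_cvg_to uy um).
  by apply: nearW => n; apply: ltW; case: (hs (f n)).
have [->|w0] := eqVneq w 0; first by rewrite dot0r.
have w2 : 0 < `|w| ^+ 2 by rewrite exprn_gt0// normr_gt0.
(* The best scalar correction of [y] along [w] cannot improve the distance. *)
have : m <= `|(u - y) - (dot (u - y) w / `|w| ^+ 2) *: w| ^+ 2.
  apply: ge_inf; first by case: Slb.
  exists (y + (dot (u - y) w / `|w| ^+ 2) *: w); last by rewrite opprD addrA.
  by apply: subspaceD => //; exact: subspaceZ.
rewrite normB_sqr uym dotZr normrZ exprMn real_normK ?num_real//.
set p := dot _ _; set q := `|w| ^+ 2 in w2 *.
have -> : m - 2 * (p / q * p) + (p / q) ^+ 2 * q = m - p ^+ 2 / q.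
  by field; rewrite gt_eqF.
rewrite lerBrDr gerDl pmulr_lle0 ?invr_gt0// => p2.
by apply/eqP; rewrite -sqrf_eq0 eq_le p2 sqr_ge0.
Qed.

End Dot.
(** * Compact symmetric operators *)
Section CompactSymmetric.
Context d (X : measurableType d) (R : realType) (mu : {measure set X -> \bar R}).
Local Notation H := (L2 mu).
Context (B : {linear H -> H}) (Bcont : continuous B) (Bcpt : compact_operator B).
Implicit Types (u v w y : H) (s : nat -> H) (F : set H).

Let Bcl : compact (closure (B @` [set u | `|u| <= 1])).
Proof. by rewrite -precompactE. Qed.

Lemma compact_subseq s : (exists M, forall n, `|s n| <= M) ->
  exists f : nat -> nat, exists y,
    f @ \oo --> \oo /\ B (s (f n)) @[n --> \oo] --> y.
Proof.
move=> [M0 sM0]; pose M := `|M0| + 1.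
have M_gt0 : 0 < M by rewrite ltr_wpDl.
have sM n : `|M^-1 *: s n| <= 1.
  rewrite normrZ gtr0_norm ?invr_gt0// mulrC ler_pdivrMr// mul1r.
  by apply: le_trans (sM0 n) _; rewrite (le_trans (ler_norm _))// lerDl.
have [|y [_ Fy]] := @Bcl ((fun n => B (M^-1 *: s n)) @ \oo) _.
  exists 0%N => // n _; apply: subset_closure; exists (M^-1 *: s n) => //; exact: sM.
have /choice[f hf] (n : nat) :
    exists j, (n <= j)%N /\ `|B (M^-1 *: s j) - y| < n.+1%:R^-1.
  have [||x [[j /= nj <-] jy]] := Fy ((fun j => B (M^-1 *: s j)) @` [set j | (n <= j)%N])
      (ball y n.+1%:R^-1).
  - by exists n => // j nj; exists j.
  - exact: nbhsx_ballx.
  - by exists j; split=> //; rewrite distrC; move: jy; rewrite -ball_normE.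
exists f, (M *: y); split.
  apply/cvgnyPge => n; exists n => // k nk; apply: leq_trans nk _.
  by case: (hf k).
have -> : (fun n => B (s (f n))) = (fun n => M *: B (M^-1 *: s (f n))).
  by apply/funext => n; rewrite linearZ scalerA divff ?scale1r ?gt_eqF.
apply: cvgZ; [exact: cvg_cst|apply/cvgrPdist_le => e e0].
have : \forall n \near \oo, harmonic n < e :> R.
  have /cvgrPdist_lt/(_ e e0) := @cvg_harmonic R; apply: filterS => n.
  by rewrite sub0r normrN ger0_norm ?harmonic_ge0.
apply: filterS => n ne; rewrite distrC; apply: ltW; apply: lt_trans ne.
by case: (hf n).
Qed.

Hypothesis Bsym : forall u v, dot (B u) v = dot u (B v).

(** The square of the norm of [B] on an invariant closed subspace is either
    zero or the square of an eigenvalue of [B] there. Working with [B^2] avoids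
    the distinction between the two ends of the spectrum of [B]. *)
Lemma norm_attained F : subspace F ->
  (forall s y, (forall n, F (s n)) -> s @ \oo --> y -> F y) ->
  (forall v, F v -> F (B v)) ->
  exists2 m : R, forall v, F v -> `|B v| ^+ 2 <= m * `|v| ^+ 2 &
    m = 0 \/ exists e t, [/\ F e, e != 0, B e = t *: e & t ^+ 2 = m].
Proof.
move=> FS Fcl FB.
pose S := [set `|B v| ^+ 2 | v in [set v | F v /\ `|v| <= 1]]; pose m := sup S.
have F0 : F 0 by case: FS.
have Ssup : has_sup S.
  split; first by exists (`|B 0| ^+ 2), 0 => //; split=> //; rewrite normr0.
  have [N [_ NB]] := compact_bounded Bcl.
  exists ((N + 1) ^+ 2) => _ [v [_ v1] <-].
  have BvN : `|B v| <= N + 1.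
    by apply: (NB (N + 1)); [rewrite ltrDl|apply: subset_closure; exists v].
  by rewrite lerXn2r// nnegrE// (le_trans _ BvN).
have Bm v : F v -> `|B v| ^+ 2 <= m * `|v| ^+ 2.
  move=> Fv; have [->|v0] := eqVneq v 0; first by rewrite linear0 !normr0 expr0n/= mulr0.
  have nv0 : 0 < `|v| by rewrite normr_gt0.
  have -> : B v = `|v| *: B (`|v|^-1 *: v).
    by rewrite linearZ scalerA divff ?scale1r ?gt_eqF.
  rewrite normrZ normr_id exprMn mulrC ler_pM2r ?exprn_gt0//.
  apply: ub_le_sup; first by case: Ssup.
  exists (`|v|^-1 *: v) => //; split; first exact: subspaceZ.
  by rewrite normrZ normfV normr_id mulVf ?gt_eqF.
exists m => //.
have m_ge0 : 0 <= m.
  apply: ub_le_sup; first by case: Ssup.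
  exists 0; last by rewrite linear0 normr0 expr0n.
  by split=> //; rewrite normr0.
have [->|m_neq0] := eqVneq m 0; [by left|right].
have m_gt0 : 0 < m by rewrite lt_neqAle eq_sym m_neq0.
have /choice[s hs] (n : nat) :
    exists v, [/\ F v, `|v| <= 1 & m - n.+1%:R^-1 < `|B v| ^+ 2].
  have [|_ [v [Fv v1] <-] ?] := @sup_adherent _ S n.+1%:R^-1 _ Ssup; first by [].
  by exists v.
have [|f [y [ff sy]]] := @compact_subseq s; first by exists 1 => n; case: (hs n).
have Bs : `|B (s (f n))| ^+ 2 @[n --> \oo] --> m.
  apply: (@squeeze_cvgr _ _ _ _ (fun n => m - (f n).+1%:R^-1) (cst m)).
  - apply: nearW => n; have [Fs s1 /ltW ->] := hs (f n) => /=.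
    apply: le_trans (Bm _ Fs) _; rewrite ler_piMr// exprn_ile1//.
  - rewrite -[X in _ --> X]subr0; apply: cvgB; first exact: cvg_cst.
    exact: (@cvg_comp _ _ _ f (@harmonic R) _ _ _ ff (@cvg_harmonic R)).
  - exact: cvg_cst.
have ym : `|y| ^+ 2 = m := cvg_unique _ (cvg_norm_sqr sy) Bs.
have y0 : y != 0 by rewrite -norm_sqr_eq0 ym.
have Fy : F y by apply: Fcl sy => n; apply: FB; case: (hs (f n)).
(* [|B^2 s - m s|^2 <= m (m - |B s|^2)] tends to zero along the maximizing
   sequence, so its image under [B] does too. *)
have B2s : B (B (s (f n))) - m *: s (f n) @[n --> \oo] --> (0 : H).
  apply: norm_sqr_cvg0.
  apply: (@squeeze_cvgr _ _ _ _ (cst 0) (fun n => m * (m - `|B (s (f n))| ^+ 2))).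
  - apply: nearW => n; rewrite exprn_ge0//=; have [Fs s1 _] := hs (f n).
    set v := s (f n) in Fs s1 *; rewrite normB_sqr dotZr Bsym dotuu normrZ exprMn.
    rewrite (ger0_norm m_ge0).
    have := Bm _ (FB _ Fs); have : `|v| ^+ 2 <= 1 by rewrite exprn_ile1.
    move=> v1 Bv; have : m ^+ 2 * `|v| ^+ 2 <= m ^+ 2 by rewrite ler_piMr// sqr_ge0.
    by lra.
  - exact: cvg_cst.
  - rewrite -[X in _ --> X](mulr0 m) -[X in _ --> m * X](subrr m).
    by apply: cvgM; [exact: cvg_cst|apply: cvgB => //; exact: cvg_cst].
have Bcvg z l : z @ \oo --> l -> B (z n) @[n --> \oo] --> B l.
  by move=> zl; apply: continuous_cvg => //; exact: Bcont.
have B2y : B (B y) = m *: y.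
  have h : B (B (B (s (f n)))) - m *: B (s (f n)) @[n --> \oo] --> (0 : H).
    have := Bcvg _ _ B2s; rewrite linear0.
    by under eq_fun do rewrite linearB linearZ.
  apply/eqP; rewrite -subr_eq0; apply/eqP; apply: (cvg_unique (@norm_hausdorff _ H) _ h).
  by apply: cvgB; [exact: Bcvg (Bcvg _ _ sy)|apply: cvgZ => //; exact: cvg_cst].
pose r := Num.sqrt m; have r2 : r ^+ 2 = m by rewrite sqr_sqrtr.
have [Br|e0] := eqVneq (B y + r *: y) 0.
  exists y, (- r); split; rewrite ?sqrrN//.
  by apply/eqP; rewrite -subr_eq0 scaleNr opprK Br.
exists (B y + r *: y), r; split=> //.
  by apply: subspaceD; [|exact: FB|exact: subspaceZ].
by rewrite linearD linearZ B2y scalerDr scalerA -expr2 r2 addrC.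
Qed.

End CompactSymmetric.
(** * Spectral expansion of an operator with compact resolvent *)
Section Spectral.
Context d (X : measurableType d) (R : realType) (mu : {measure set X -> \bar R}).
Local Notation H := (L2 mu).
Local Notation form := (@Defs.form _ X R mu).
Context (A : operator mu) (Asa : self_adjoint A) (Age0 : nonnegative A).
Implicit Types (u v w : H) (s : nat -> H) (l : R).

Lemma op_dom_subspace : subspace (op_dom A).
Proof. by split; [exact: op_dom0|move=> *; exact: op_domP]. Qed.

Lemma op_funD u v : op_dom A u -> op_dom A v -> A (u + v) = A u + A v.
Proof. by move=> Au Av; rewrite -[u]scale1r op_linear// !scale1r. Qed.

Lemma op_fun0 : A 0 = 0.
Proof.
by apply: (addrI (A 0)); rewrite addr0 -op_funD ?addr0//; exact: op_dom0.
Qed.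

Lemma op_funZ l u : op_dom A u -> A (l *: u) = l *: A u.
Proof.
by move=> Au; rewrite -(addr0 (l *: u)) op_linear ?op_fun0 ?addr0//; exact: op_dom0.
Qed.

Lemma op_funB u v : op_dom A u -> op_dom A v -> A (u - v) = A u - A v.
Proof. by move=> Au Av; rewrite addrC -scaleN1r op_linear// scaleN1r addrC. Qed.

Lemma op_sym u v : op_dom A u -> op_dom A v -> dot (A u) v = dot u (A v).
Proof.
move=> Au Av; have [_ AG] := Asa.
by have : graph A (v, A v) by []; rewrite -AG => /(_ u Au).
Qed.

Lemma eigspace_subspace l : subspace (eigspace A l).
Proof.
split; first by split; [exact: op_dom0|rewrite op_fun0 scaler0].
move=> a u v [Au ul] [Av vl]; split; first exact: op_domP.
by rewrite op_linear// ul vl scalerDr !scalerA mulrC.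
Qed.

Lemma eigspace_orth l l' u v : l != l' ->
  eigspace A l u -> eigspace A l' v -> dot u v = 0.
Proof.
move=> ll' [Au ul] [Av vl]; have := op_sym Au Av.
rewrite ul vl dotZl dotZr => /eqP; rewrite -subr_eq0 -mulrBl mulf_eq0 subr_eq0.
by rewrite (negPf ll') => /eqP.
Qed.

Context (z : R) (B : {linear H -> H}).
Hypotheses (AB : is_resolvent A z B) (Bcpt : compact_operator B).

Let Bcont : continuous B. Proof. by case: AB. Qed.

Lemma resolvent_sym u v : dot (B u) v = dot u (B v).
Proof.
have [_ BA _] := AB; have [Bu Eu] := BA u; have [Bv Ev] := BA v.
rewrite -[v in LHS]Ev -[u in RHS]Eu dotBr dotBl dotZr dotZl.
by rewrite op_sym.
Qed.

Lemma eigvalue_neq l : eigvalue A l -> l != z.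
Proof.
move=> [u [Au ul] u0]; apply/eqP => lz; have [_ _ BA] := AB.
by move: (BA u Au); rewrite ul lz subrr linear0 => /esym/eqP; rewrite (negPf u0).
Qed.

Lemma eigspace_resolvent l u : l != z -> eigspace A l u -> B u = (l - z)^-1 *: u.
Proof.
move=> lz [Au ul]; have [_ _ BA] := AB; have := BA u Au.
rewrite ul -scalerBl linearZ/= => h.
by rewrite -[in RHS]h scalerA mulVf ?scale1r// subr_eq0.
Qed.

Lemma resolvent_eigspace t u : t != 0 -> B u = t *: u -> eigspace A (z + t^-1) u.
Proof.
move=> t0 Bu; have [_ BA _] := AB; have [ABu Eu] := BA u.
have uE : u = t^-1 *: B u by rewrite Bu scalerA mulVf ?scale1r.
have Au : op_dom A u by rewrite uE; exact: subspaceZ op_dom_subspace _.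
split=> //; move: Eu; rewrite Bu op_funZ// => Eu.
rewrite scalerDl -[in t^-1 *: _]Eu scalerBr !scalerA mulVf// scale1r.
by rewrite mulrAC mulVf// mul1r addrC subrK.
Qed.

Context (lam : nat -> R).
Hypotheses (lam0 : lam 0%N = 0) (lam_incr : forall i j : nat, (i < j)%N -> lam i < lam j).
Hypotheses (lam_infty : lam @ \oo --> +oo).
Hypothesis (lam_eig : [set l | eigvalue A l] = range lam).
Local Notation E k := (eigspace A (lam k)).

Lemma lam_le i j : (i <= j)%N -> lam i <= lam j.
Proof. by rewrite leq_eqVlt => /predU1P[->//|/lam_incr/ltW]. Qed.

Lemma lam_ge0 k : 0 <= lam k.
Proof. by rewrite -lam0 lam_le. Qed.

Lemma lam_neq i j : i != j -> lam i != lam j.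
Proof.
by case: ltngtP => // ij _; [rewrite lt_eqF|rewrite gt_eqF]; rewrite ?lam_incr.
Qed.

Lemma lam_eigvalue k : eigvalue A (lam k).
Proof. by rewrite -[eigvalue A _]/([set l | eigvalue A l] _) lam_eig; exists k. Qed.

Lemma lam_neq_z k : lam k != z. Proof. exact/eigvalue_neq/lam_eigvalue. Qed.

Definition eigproj k u := oproj (E k) u.

(** The resolvent acts as a nonzero scalar on [E k], so its compactness provides
    limit points of the bounded sequences of [E k]. *)
Lemma eigprojP k u : is_oproj (E k) u (eigproj k u).
Proof.
apply: oproj_exists; first exact: eigspace_subspace.
move=> s Es bs; have [f [y [ff sy]]] := compact_subseq Bcpt bs.
have lz : lam k - z != 0 by rewrite subr_eq0 lam_neq_z.
have sw : s (f n) @[n --> \oo] --> (lam k - z) *: y.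
  have -> : (fun n => s (f n)) = (fun n => (lam k - z) *: B (s (f n))).
    apply/funext => n; rewrite (eigspace_resolvent (lam_neq_z k) (Es _)).
    by rewrite scalerA divff ?scale1r.
  by apply: cvgZ => //; exact: cvg_cst.
exists f, ((lam k - z) *: y); split=> //.
have := @resolvent_eigspace (lam k - z)^-1 ((lam k - z) *: y).
rewrite invrK subrKC; apply; first by rewrite invr_eq0.
rewrite scalerA mulVf// scale1r.
apply: (cvg_unique (@norm_hausdorff _ H) _ sy).
by apply: continuous_cvg => //; exact: Bcont.
Qed.

Lemma eigproj_eq k u v : E k v -> (forall w, E k w -> dot (u - v) w = 0) ->
  eigproj k u = v.
Proof. by move=> Ev uv; apply: oproj_eq => //; exact: eigspace_subspace. Qed.

Lemma eigproj_in k u : E k (eigproj k u). Proof. by case: (eigprojP k u). Qed.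

Lemma dot_eigproj k u w : E k w -> dot (eigproj k u) w = dot u w.
Proof.
by move=> /(proj2 (eigprojP k u))/eqP; rewrite dotBl subr_eq0 => /eqP.
Qed.

Lemma eigproj_orth j k u : E j u -> j != k -> eigproj k u = 0.
Proof.
move=> Eu jk; apply: eigproj_eq => [|w Ew]; first by case: (eigspace_subspace (lam k)).
by rewrite subr0; apply: eigspace_orth Eu Ew; exact: lam_neq.
Qed.

Lemma eigprojB k u v : eigproj k (u - v) = eigproj k u - eigproj k v.
Proof.
apply: eigproj_eq => [|w Ew].
  by apply: subspaceB; [exact: eigspace_subspace|exact: eigproj_in..].
by rewrite !dotBl !(dot_eigproj _ Ew) subrr.
Qed.

Lemma eigproj_resolvent k u : eigproj k (B u) = B (eigproj k u).
Proof.
have Bw w : E k w -> E k (B w).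
  move=> Ew; rewrite (eigspace_resolvent (lam_neq_z k) Ew).
  by apply: subspaceZ => //; exact: eigspace_subspace.
apply: eigproj_eq => [|w Ew]; first exact/Bw/eigproj_in.
by rewrite dotBl !resolvent_sym (dot_eigproj _ (Bw _ Ew)) subrr.
Qed.

Lemma eigproj_op k u : op_dom A u -> eigproj k (A u) = lam k *: eigproj k u.
Proof.
move=> Au; apply: eigproj_eq => [|w Ew].
  by apply: subspaceZ; [exact: eigspace_subspace|exact: eigproj_in].
rewrite dotBl dotZl (dot_eigproj _ Ew); case: Ew => Aw Ew.
by rewrite op_sym// Ew dotZr subrr.
Qed.

Lemma dot_eigproj_self k u : dot (eigproj k u) u = `|eigproj k u| ^+ 2.
Proof. by rewrite dotC -dotuu (dot_eigproj _ (eigproj_in k u)). Qed.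

(** The projection onto [E 0 + ... + E n]. *)
Definition eigpart n u : H := \sum_(k < n.+1) eigproj k u.

Lemma eigpart_orth n k u w : (k <= n)%N -> E k w -> dot (u - eigpart n u) w = 0.
Proof.
move=> kn Ew; have kn' : (k < n.+1)%N by [].
rewrite dotBl dot_suml (bigD1 (Ordinal kn'))//= big1 ?addr0.
  by rewrite (dot_eigproj _ Ew) subrr.
move=> i ik; apply: eigspace_orth (eigproj_in _ _) Ew; apply: lam_neq.
by apply: contra ik => /eqP ik; apply/eqP/val_inj.
Qed.

Lemma dot_eigpart n u v : dot (u - eigpart n u) (eigpart n v) = 0.
Proof.
rewrite dotC dot_suml big1// => k _; rewrite dotC.
by apply: (@eigpart_orth n k) (eigproj_in _ _); rewrite -ltnS.
Qed.

Lemma norm_eigpart n u : `|eigpart n u| ^+ 2 = \sum_(k < n.+1) `|eigproj k u| ^+ 2.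
Proof.
have := dot_eigpart n u u; rewrite dotBl dotuu => /eqP; rewrite subr_eq0 => /eqP <-.
by rewrite dotC dot_suml; apply: eq_bigr => k _; exact: dot_eigproj_self.
Qed.

Lemma norm_eigpart_tail n u :
  `|u - eigpart n u| ^+ 2 = `|u| ^+ 2 - \sum_(k < n.+1) `|eigproj k u| ^+ 2.
Proof.
rewrite -norm_eigpart; have := normD_sqr_orth (dot_eigpart n u u).
by rewrite subrK => ->; rewrite addrK.
Qed.

Lemma norm_eigpart_tail_le n u : `|u - eigpart n u| <= `|u|.
Proof.
rewrite -(@ler_pXn2r _ 2)// ?nnegrE// norm_eigpart_tail lerBlDr lerDl.
by apply: sumr_ge0 => k _; exact: exprn_ge0.
Qed.

Lemma eigpartB n u v : eigpart n (u - v) = eigpart n u - eigpart n v.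
Proof. by rewrite /eigpart -sumrB; apply: eq_bigr => k _; exact: eigprojB. Qed.

Lemma eigpart_eigsum n u : eigsum A lam n (eigpart n u).
Proof. by exists (fun k => eigproj k u) => // k _; exact: eigproj_in. Qed.

Lemma eigproj_eigsum n k u : eigsum A lam n u -> (n < k)%N -> eigproj k u = 0.
Proof.
move=> [v Ev ->] nk; apply: eigproj_eq => [|w Ew].
  by case: (eigspace_subspace (lam k)).
rewrite subr0 dot_suml big1// => i _.
apply: eigspace_orth (Ev i _) Ew; last by rewrite -ltnS.
by apply: lam_neq; rewrite ltn_eqF// (leq_trans _ nk).
Qed.

Lemma eigpart_dom n u : op_dom A (eigpart n u).
Proof.
rewrite /eigpart; elim/big_ind: _ => [|*|k _]; first exact: op_dom0.
  exact: subspaceD op_dom_subspace _ _.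
by case: (eigproj_in k u).
Qed.

Lemma op_eigpart n u : A (eigpart n u) = \sum_(k < n.+1) lam k *: eigproj k u.
Proof.
suff [] : op_dom A (eigpart n u) /\
  A (eigpart n u) = \sum_(k < n.+1) lam k *: eigproj k u by [].
rewrite /eigpart; elim/big_rec2: _ => [|k v w _ [Aw AwE]].
  by split; [exact: op_dom0|exact: op_fun0].
have [Ak AkE] := eigproj_in k u; split; first exact: subspaceD op_dom_subspace _ _.
by rewrite op_funD// AkE AwE.
Qed.

(** An eigenvector of the resolvent that is orthogonal to the first eigenspaces
    of [A] belongs to a later one; this bounds the eigenvalue at which the norm of
    the resolvent on that orthogonal complement is attained. *)
Lemma resolvent_tail n v : z < lam n.+1 ->
  (forall k w, (k <= n)%N -> E k w -> dot v w = 0) ->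
  `|B v| <= `|v| / (lam n.+1 - z).
Proof.
move=> zn Fv; have c0 : 0 < lam n.+1 - z by rewrite subr_gt0.
pose F := [set v | forall k w, (k <= n)%N -> E k w -> dot v w = 0].
have FS : subspace F.
  split=> [k w _ _|a u w Fu Fw k y kn Ey]; first by rewrite dot0l.
  by rewrite dotDl dotZl (Fu k)// (Fw k)// mulr0 addr0.
have Fcl s y : (forall n, F (s n)) -> s @ \oo --> y -> F y.
  move=> Fs sy k w kn Ew; have := @cvg_dotl _ _ _ _ _ _ w sy.
    have -> : (fun j => dot (s j) w) = cst 0 by apply/funext => j; exact: (Fs j k).
    by move/(cvg_unique (@norm_hausdorff _ R^o) (cvg_cst 0)).
have FB u : F u -> F (B u).
  move=> Fu k w kn Ew; rewrite resolvent_sym (eigspace_resolvent (lam_neq_z k) Ew).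
  by rewrite dotZr (Fu k)// mulr0.
have [m Bm m_eig] := norm_attained Bcont Bcpt resolvent_sym FS Fcl FB.
have mc : m <= (lam n.+1 - z)^-1 ^+ 2.
  have [->|[e [t [Fe e0 Be <-]]]] := m_eig; first by rewrite exprn_ge0// invr_ge0 ltW.
  have t0 : t != 0.
    apply: contra e0 => /eqP t0; rewrite t0 scale0r in Be.
    by have [_ BA _] := AB; have [_] := BA e; rewrite Be op_fun0 scaler0 subr0 => <-.
  have Ee := resolvent_eigspace t0 Be.
  have [k _ kt] : range lam (z + t^-1) by rewrite -lam_eig; exists e.
  rewrite -kt in Ee.
  have nk : (n < k)%N.
    rewrite ltnNge; apply/negP => kn; move: e0.
    by rewrite -norm_sqr_eq0 -dotuu (Fe k e kn Ee) eqxx.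
  have tk : t = (lam k - z)^-1 by rewrite kt addrC addKr invrK.
  have ck : lam n.+1 - z <= lam k - z by rewrite lerD2r lam_le.
  rewrite tk lerXn2r// ?nnegrE ?invr_ge0 ?(le_trans (ltW c0))//.
  by rewrite lef_pV2// posrE (lt_le_trans c0).
rewrite -(@ler_pXn2r _ 2)// ?nnegrE// ?divr_ge0 ?(ltW c0)//.
rewrite exprMn mulrC; apply: le_trans (Bm v Fv) _.
by rewrite ler_wpM2r// exprn_ge0.
Qed.

Lemma eigpart_cvg_dom u : op_dom A u -> eigpart n u @[n --> \oo] --> u.
Proof.
move=> Au; have [_ _ BA] := AB; set g := A u - z *: u.
have uB : B g = u by exact: BA.
apply/cvgrPdist_le => e e0.
have : \forall n \near \oo, z + 1 + `|g| / e <= lam n.+1.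
  move/cvgryPge: lam_infty => /(_ (z + 1 + `|g| / e)) [N _ hN].
  by exists N => // n /= Nn; apply: hN => /=; exact: leqW.
apply: filterS => n zn.
have ge0 : 0 <= `|g| / e by rewrite divr_ge0// ltW.
have c0 : 0 < lam n.+1 - z by lra.
have -> : u - eigpart n u = B (g - eigpart n g).
  rewrite linearB/= uB; congr (_ - _); rewrite /eigpart linear_sum/=.
  by apply: eq_bigr => k _; rewrite -eigproj_resolvent uB.
have zn' : z < lam n.+1 by lra.
apply: le_trans (resolvent_tail zn' _) _; first by move=> k w; exact: eigpart_orth.
rewrite ler_pdivrMr// (le_trans (norm_eigpart_tail_le n g))//.
by rewrite mulrC -ler_pdivrMr//; lra.
Qed.

(** * The quadratic form *)

Definition eigform n u : R := \sum_(k < n.+1) lam k * `|eigproj k u| ^+ 2.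

Lemma eigform_ge0 n u : 0 <= eigform n u.
Proof. by apply: sumr_ge0 => k _; rewrite mulr_ge0 ?exprn_ge0 ?lam_ge0. Qed.

Lemma op_formE n u : op_dom A u ->
  dot (A (u - eigpart n u)) (u - eigpart n u) = dot (A u) u - eigform n u.
Proof.
move=> Au; have Ap := eigpart_dom n u; have Av : op_dom A (u - eigpart n u).
  exact: subspaceB op_dom_subspace _ _.
(* The tail is orthogonal to the eigenspaces carrying [A (eigpart n u)]. *)
have Avp : dot (A (u - eigpart n u)) (eigpart n u) = 0.
  rewrite op_sym// op_eigpart dotC dot_suml big1// => k _.
  rewrite dotZl dotC (@eigpart_orth n k) ?mulr0//; first by rewrite -ltnS.
  exact: eigproj_in.
rewrite dotBr Avp subr0 op_funB// dotBl; congr (_ - _).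
rewrite op_eigpart dot_suml; apply: eq_bigr => k _.
by rewrite dotZl dot_eigproj_self.
Qed.

Lemma eigform_le n u : op_dom A u -> eigform n u <= dot (A u) u.
Proof.
move=> Au; rewrite -subr_ge0 -op_formE//; apply: Age0.
exact: subspaceB op_dom_subspace Au (eigpart_dom n u).
Qed.

Lemma op_form_parallelogram u v : op_dom A u -> op_dom A v ->
  dot (A (u + v)) (u + v) <= 2 * dot (A u) u + 2 * dot (A v) v.
Proof.
move=> Au Av; have := Age0 (subspaceB op_dom_subspace Au Av).
rewrite op_funB// op_funD// !(dotBl, dotBr, dotDl, dotDr); lra.
Qed.

(** The part of the form missed by [eigform n] is itself a nonnegative quadratic
    form dominated by the full one; this makes the convergence in
    [eigform_cvg_dom] uniform along sequences that are Cauchy for the form. *)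
Lemma eigform_tail_le n u v : op_dom A u -> op_dom A v ->
  dot (A u) u - eigform n u <=
    2 * (dot (A v) v - eigform n v) + 2 * dot (A (u - v)) (u - v).
Proof.
move=> Au Av; have Auv := subspaceB op_dom_subspace Au Av.
have tail_dom w : op_dom A w -> op_dom A (w - eigpart n w).
  by move=> Aw; exact: subspaceB op_dom_subspace Aw (eigpart_dom n w).
rewrite -!op_formE//.
have -> : u - eigpart n u = (v - eigpart n v) + (u - v - eigpart n (u - v)).
  by rewrite eigpartB opprB addrACA subrKC addKr.
apply: le_trans (op_form_parallelogram (tail_dom v Av) (tail_dom _ Auv)) _.
by rewrite lerD2l ler_pM2l// op_formE// lerBlDr lerDl eigform_ge0.
Qed.

(** The missing part is the form at the tail [v = u - eigpart n u]; since
    [A v] is the tail of [A u], it is at most [|A u| * |v|]. *)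
Lemma eigform_cvg_dom u : op_dom A u ->
  eigform n u @[n --> \oo] --> dot (A u) u.
Proof.
move=> Au.
have tail0 : `|A u| * `|u - eigpart n u| @[n --> \oo] --> `|A u| * `|u - u|.
  apply: cvgM; first exact: cvg_cst.
  by apply: cvg_norm; apply: cvgB; [exact: cvg_cst|exact: eigpart_cvg_dom].
rewrite subrr normr0 mulr0 in tail0.
rewrite -[X in _ --> X]subr0.
apply: (@squeeze_cvgr _ _ _ _
  (fun n => dot (A u) u - `|A u| * `|u - eigpart n u|) (cst (dot (A u) u))).
- apply: nearW => n; rewrite eigform_le// andbT lerBlDl -lerBlDr -op_formE//.
  have Ap := eigpart_dom n u.
  apply: le_trans (ler_norm _) _; apply: le_trans (cauchy_schwarz _ _) _.
  rewrite ler_wpM2r// op_funB//.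
  have -> : A (eigpart n u) = eigpart n (A u).
    by rewrite op_eigpart; apply: eq_bigr => k _; rewrite eigproj_op.
  exact: norm_eigpart_tail_le.
- by apply: cvgB => //; exact: cvg_cst.
- by rewrite subr0; exact: cvg_cst.
Qed.

Lemma norm_eigproj_le k u : `|eigproj k u| <= `|u|.
Proof.
rewrite -(@ler_pXn2r _ 2)// ?nnegrE//.
have : 0 <= `|u - eigproj k u| ^+ 2 by exact: exprn_ge0.
by rewrite normB_sqr dotC dot_eigproj_self; lra.
Qed.

Lemma cvg_eigproj k s u : s @ \oo --> u ->
  eigproj k (s n) @[n --> \oo] --> eigproj k u.
Proof.
move=> /cvgrPdist_le su; apply/cvgrPdist_le => e /su; apply: filterS => n.
by apply: le_trans; rewrite -eigprojB norm_eigproj_le.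
Qed.

Lemma cvg_eigform k s u : s @ \oo --> u ->
  eigform k (s n) @[n --> \oo] --> eigform k u.
Proof.
move=> su; apply: cvg_big => [|i _]; first exact: add_continuous.
apply: cvgM; first exact: cvg_cst.
exact/cvg_norm_sqr/cvg_eigproj.
Qed.

(** The tails of [eigform] are uniformly small along the approximating sequence,
    so the limits in the sequence and in the number of eigenspaces commute. Every
    approximating sequence thus yields the value [sum_k lam k * |eigproj k u|^2],
    which identifies the form with this series. *)
Lemma form_approx_cvg s u : form_approx A s u -> exists2 l : R,
  eigform n u @[n --> \oo] --> l & dot (A (s n)) (s n) @[n --> \oo] --> l.
Proof.
move=> [As su sC]; pose q w := dot (A w) w.
have tail_unif e : 0 < e -> exists N, forall n k, (N <= n)%N -> (N <= k)%N ->
    q (s n) - eigform k (s n) <= e.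
  move=> e0; have [|N hN] := sC (e / 4); first by rewrite divr_gt0.
  have /cvgrPdist_le/(_ (e / 4)) := eigform_cvg_dom (As N).
  case; [by rewrite divr_gt0|move=> K _ hK].
  exists (maxn N K) => n k; rewrite !geq_max => /andP[Nn _] /andP[_ Kk].
  apply: le_trans (eigform_tail_le k (As n) (As N)) _.
  have := hN n N Nn (leqnn _); have := hK k Kk => /=.
  by rewrite ger0_norm ?subr_ge0 ?eigform_le//; lra.
have [|N hN] := sC 1; first by [].
have bnd k : eigform k u <= 2 * q (s N) + 2.
  have := @cvg_eigform k s u su; rewrite -(cvg_shiftn N) => qu.
  apply: (ler_cvg_to qu (cvg_cst _)); apply: nearW => n /=.
  have Nn : (N <= n + N)%N by exact: leq_addl.
  apply: le_trans (eigform_le _ (As _)) _.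
  have := op_form_parallelogram (As N) (subspaceB op_dom_subspace (As (n + N)%N) (As N)).
  by rewrite subrKC => h; have := hN _ _ Nn (leqnn _); rewrite /q; lra.
have incr : nondecreasing_seq (fun n => eigform n u).
  apply/nondecreasing_seqP => n; rewrite /eigform [in leRHS]big_ord_recr/= lerDl.
  by rewrite mulr_ge0 ?exprn_ge0 ?lam_ge0.
have [l ul] : exists l : R, eigform n u @[n --> \oo] --> l.
  exists (limn (fun n => eigform n u)); apply: nondecreasing_is_cvgn => //.
  by exists (2 * q (s N) + 2) => _ [k _ <-]; exact: bnd.
exists l => //; apply/cvgrPdist_le => e e0.
have e3 : 0 < e / 3 by rewrite divr_gt0.
have [M hM] := tail_unif _ e3.
have /cvgrPdist_le/(_ _ e3)[K _ hK] := ul.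
pose k := maxn M K.
have /cvgrPdist_le/(_ _ e3)[K' _ hK'] := @cvg_eigform k s u su.
exists (maxn M K') => // n /=; rewrite geq_max => /andP[Mn Kn].
have h1 : eigform k (s n) <= q (s n) by exact: eigform_le.
have h2 : q (s n) - eigform k (s n) <= e / 3 by exact: hM (leq_maxl _ _).
have h3 : `|l - eigform k u| <= e / 3 := hK k (leq_maxr _ _).
have h4 : `|eigform k u - eigform k (s n)| <= e / 3 := hK' n Kn.
change (`|l - q (s n)| <= e).
move: h1 h2 h3 h4; move: (q _) (eigform _ _) (eigform _ _) => a b c.
by rewrite !ler_norml => h1 h2 /andP[h3 h4] /andP[h5 h6]; apply/andP; split; lra.
Qed.

Lemma form_cvg u : form_dom A u -> eigform n u @[n --> \oo] --> form A u.
Proof.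
move=> [s su]; have [l ul sl] := form_approx_cvg su.
have : [set e | exists2 s, form_approx A s u &
  dot (A (s n)) (s n) @[n --> \oo] --> e] (form A u) by apply: (@xgetI _ 0 _ l); exists s.
move=> [s' /form_approx_cvg[l' ul' sl'] sf].
by rewrite (cvg_unique _ sf sl').
Qed.

Lemma eigpart_cvg u : form_dom A u -> eigpart n u @[n --> \oo] --> u.
Proof.
move=> [s [As su _]]; apply/cvgrPdist_le => e e0.
have e2 : 0 < e / 2 by rewrite divr_gt0.
have /cvgrPdist_le/(_ _ e2)[N _ /(_ N (leqnn _)) hN] := su.
have /cvgrPdist_le/(_ _ e2) := eigpart_cvg_dom (As N).
apply: filterS => n hn.
have -> : u - eigpart n u = (u - s N - eigpart n (u - s N)) + (s N - eigpart n (s N)).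
  by rewrite eigpartB opprB addrACA subrK [X in _ = u + X]addrC addKr.
apply: le_trans (ler_normD _ _) _.
rewrite (splitr e); apply: lerD; last exact: hn.
exact: le_trans (norm_eigpart_tail_le _ _) hN.
Qed.

Lemma parseval u : form_dom A u ->
  \sum_(k < n.+1) `|eigproj k u| ^+ 2 @[n --> \oo] --> `|u| ^+ 2.
Proof.
move=> /eigpart_cvg/cvg_norm_sqr.
by under eq_fun do rewrite norm_eigpart.
Qed.
(** * Distances to sums of eigenspaces *)

Lemma form_dom_op u : op_dom A u -> form_dom A u.
Proof.
move=> Au; exists (fun=> u); split=> //; first exact: cvg_cst.
by move=> e e0; exists 0%N => m n _ _; rewrite subrr dot0r.
Qed.

Lemma form_domB u v : form_dom A u -> op_dom A v -> form_dom A (u - v).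
Proof.
move=> [s [As su sC]] Av; exists (fun n => s n - v); split.
- by move=> n; exact: subspaceB op_dom_subspace _ _.
- by apply: cvgB => //; exact: cvg_cst.
- move=> e /sC[N hN]; exists N => m n Nm Nn.
  by rewrite opprB addrA subrK; exact: hN.
Qed.

Lemma eigsum_dom n u : eigsum A lam n u -> op_dom A u.
Proof.
move=> [v Ev ->]; elim/big_ind: _ => [|*|k _]; first exact: op_dom0.
  exact: subspaceD op_dom_subspace _ _.
by case: (Ev k (ltn_ord k)).
Qed.

Lemma eigpart_id n u : eigsum A lam n u -> eigpart n u = u.
Proof.
move=> [v Ev uE]; apply/esym/eqP; rewrite -subr_eq0 -norm_sqr_eq0 -dotuu.
rewrite dotBr dot_eigpart subr0 [X in dot _ X]uE dotC dot_suml big1// => k _.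
have kn : (k <= n)%N := ltn_ord k.
by rewrite dotC (eigpart_orth _ kn (Ev k kn)).
Qed.

Lemma eigproj_tail n k u : (k <= n)%N -> eigproj k (u - eigpart n u) = 0.
Proof.
move=> kn; apply: eigproj_eq => [|w Ew]; first by case: (eigspace_subspace (lam k)).
by rewrite subr0 (eigpart_orth _ kn Ew).
Qed.

Lemma eigsumP n u : form_dom A u ->
  eigsum A lam n u <-> forall k, (n < k)%N -> eigproj k u = 0.
Proof.
move=> Du; split=> [Mu k nk|u0]; first exact: eigproj_eigsum Mu nk.
suff <- : eigpart n u = u by exact: eigpart_eigsum.
apply: (cvg_unique (@norm_hausdorff _ H) _ (eigpart_cvg Du)).
apply: cvg_near_cst; exists n => // m /= nm; rewrite /eigpart.
rewrite -!(big_mkord xpredT (fun k => eigproj k u)) (big_cat_nat _ (n := n.+1))//=.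
rewrite [X in _ + X]big_nat_cond [X in _ + X]big1 ?addr0// => k.
by rewrite andbT => /andP[nk _]; exact: u0.
Qed.

Lemma dist2_eigsum n u : dist2_sq (eigsum A lam n) u =
  `|u| ^+ 2 - \sum_(k < n.+1) `|eigproj k u| ^+ 2.
Proof.
rewrite -norm_eigpart_tail; apply/eqP; rewrite eq_le; apply/andP; split.
  apply: ge_inf; first by exists 0 => _ [w _ <-]; exact: exprn_ge0.
  by exists (eigpart n u) => //; exact: eigpart_eigsum.
apply: lb_le_inf.
  by exists (`|u - eigpart n u| ^+ 2), (eigpart n u) => //; exact: eigpart_eigsum.
move=> _ [w Mw <-].
have -> : u - w = (u - eigpart n u) + eigpart n (u - w).
  by rewrite eigpartB (eigpart_id Mw) addrA subrK.
by rewrite (normD_sqr_orth (dot_eigpart n u (u - w))) lerDl exprn_ge0.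
Qed.

Lemma eigform_split n m u : (n <= m)%N -> eigform m u =
  eigform n u + \sum_(n.+1 <= k < m.+1) lam k * `|eigproj k u| ^+ 2.
Proof.
move=> nm; rewrite /eigform -!(big_mkord xpredT (fun k => lam k * `|eigproj k u| ^+ 2)).
exact: big_cat_nat.
Qed.

(** Subtracting [w] changes only the components of index at most [n], so that
    minimizing over [w] amounts to cancelling these. *)
Lemma form_sub_eigsum n u w : form_dom A u -> eigsum A lam n w ->
  form A (u - w) = form A u - eigform n u + eigform n (u - w).
Proof.
move=> Du Mw; have Duw := form_domB Du (eigsum_dom Mw).
apply: (cvg_unique (@norm_hausdorff _ R^o) (form_cvg Duw)).
have h : eigform m u - eigform n u + eigform n (u - w) @[m --> \oo] -->
    form A u - eigform n u + eigform n (u - w).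
  apply: cvgD; last exact: cvg_cst.
  by apply: cvgB; [exact: form_cvg|exact: cvg_cst].
apply: cvg_trans h; apply: near_eq_cvg; exists n => // m /= nm.
have tailE : \sum_(n.+1 <= k < m.+1) lam k * `|eigproj k (u - w)| ^+ 2 =
    \sum_(n.+1 <= k < m.+1) lam k * `|eigproj k u| ^+ 2.
  apply: eq_big_nat => k /andP[nk _].
  by rewrite eigprojB (eigproj_eigsum Mw nk) subr0.
have cancel (a b c e t : R) : a = b + t -> e = c + t -> a - b + c = e.
  by move=> -> ->; ring.
apply: cancel (eigform_split u nm) _; rewrite -tailE; exact: eigform_split.
Qed.

Lemma distE_eigsum n u : form_dom A u ->
  distE_sq A (eigsum A lam n) u = form A u - eigform n u.
Proof.
move=> Du; have Mp := eigpart_eigsum n u.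
have min w : eigsum A lam n w -> form A u - eigform n u <= form A (u - w).
  by move=> Mw; rewrite (form_sub_eigsum Du Mw) lerDl eigform_ge0.
apply/eqP; rewrite eq_le; apply/andP; split.
  have -> : form A u - eigform n u = form A (u - eigpart n u).
    suff h : eigform n (u - eigpart n u) = 0 by rewrite (form_sub_eigsum Du Mp) h addr0.
    apply: big1 => k _.
    by rewrite eigproj_tail ?normr0 ?expr0n ?mulr0// -ltnS.
  apply: ge_inf; last by exists (eigpart n u).
  by exists (form A u - eigform n u) => _ [w Mw <-]; exact: min.
apply: lb_le_inf; first by exists (form A (u - eigpart n u)), (eigpart n u).
by move=> _ [w Mw <-]; exact: min.
Qed.

(** * The remainder *)

(** A closed form of [sum_(k >= 3) (lam k - lam 2) |eigproj k u|^2]: the term of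
    index 2 vanishes and those of index 0 and 1 are taken out of the full sum. *)
Definition excess u : R := form A u - lam 2%N * `|u| ^+ 2
  + lam 2%N * `|eigproj 0 u| ^+ 2 + (lam 2%N - lam 1%N) * `|eigproj 1 u| ^+ 2.

Lemma varianceE u : Defs.variance A u = `|u| ^+ 2 - `|eigproj 0 u| ^+ 2.
Proof.
have := norm_eigpart_tail 0 u; rewrite /eigpart !big_ord_recl !big_ord0 !addr0 => <-.
by rewrite /Defs.variance /eigproj lam0.
Qed.

Lemma deficit_dist2 u : deficit A lam u =
  (lam 2%N - lam 1%N) * dist2_sq (eigsum A lam 1) u + excess u.
Proof.
rewrite /deficit varianceE dist2_eigsum !big_ord_recl big_ord0 /= /excess; ring.
Qed.

Lemma deficit_distE u : form_dom A u -> deficit A lam u =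
  (1 - lam 1%N / lam 2%N) * distE_sq A (eigsum A lam 1) u
  + lam 1%N / lam 2%N * excess u.
Proof.
move=> Du; have lam2 : lam 2%N != 0 by rewrite gt_eqF// -lam0 lam_incr.
rewrite /deficit varianceE distE_eigsum// /eigform !big_ord_recl big_ord0 /= /excess.
by rewrite lam0; field.
Qed.

(** Stated for arbitrary sequences; [excess_series] uses the squared norms of
    the components for [a], so that the left side tends to [excess u]. *)
Lemma remainder_partial (l a : nat -> R) n : l 0%N = 0 ->
  \sum_(k < (n + 2).+1) l k * a k - l 2%N * (\sum_(k < (n + 2).+1) a k)
    + l 2%N * a 0%N + (l 2%N - l 1%N) * a 1%N
  = \sum_(3 <= k < n + 3) (l k - l 2%N) * a k.
Proof.
move=> l0; elim: n => [|n IH].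
  by rewrite big_geq// !big_ord_recr !big_ord0/= l0; ring.
rewrite addSnnS big_ord_recr [X in _ - l 2%N * X]big_ord_recr/=.
rewrite addSn big_nat_recr ?leq_addl//= -IH -addnS; ring.
Qed.

Lemma excess_series u : form_dom A u -> (excess u)%:E =
  (\sum_(3 <= k <oo) ((lam k - lam 2%N) * `|eigproj k u| ^+ 2)%:E)%E.
Proof.
move=> Du; apply/esym/cvg_lim => //.
under eq_fun do rewrite sumEFin.
apply: cvg_EFin; first exact: nearW.
rewrite -(cvg_shiftn 3).
have h : eigform (n + 2) u
    - lam 2%N * (\sum_(k < (n + 2).+1) `|eigproj k u| ^+ 2)
    + lam 2%N * `|eigproj 0 u| ^+ 2 + (lam 2%N - lam 1%N) * `|eigproj 1 u| ^+ 2
    @[n --> \oo] --> excess u.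
  apply: cvgD; last exact: cvg_cst.
  apply: cvgD; last exact: cvg_cst.
  apply: cvgB; first by have := form_cvg Du; rewrite -(cvg_shiftn 2).
  apply: cvgM; first exact: cvg_cst.
  by have := parseval Du; rewrite -(cvg_shiftn 2).
apply: cvg_trans h; apply: near_eq_cvg; apply: nearW => n /=.
exact: (remainder_partial (fun k => `|eigproj k u| ^+ 2) n lam0).
Qed.

Lemma excess_terms_ge0 u k : (3 <= k)%N ->
  (0 <= ((lam k - lam 2%N) * `|eigproj k u| ^+ 2)%:E)%E.
Proof.
by move=> k3; rewrite lee_fin mulr_ge0 ?exprn_ge0// subr_ge0 lam_le// ltnW.
Qed.

Lemma excess_ge0 u : form_dom A u -> 0 <= excess u.
Proof.
move=> Du; rewrite -lee_fin excess_series//; apply: nneseries_ge0 => k k3 _.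
exact: excess_terms_ge0.
Qed.

Lemma excess_eq0 u : form_dom A u -> excess u = 0 <-> eigsum A lam 2 u.
Proof.
move=> Du; split=> [T0|/(eigsumP _ Du) u0]; last first.
  apply: EFin_inj; rewrite excess_series// eseries0// => k k3 _.
  by rewrite u0// normr0 expr0n mulr0.
apply/(eigsumP _ Du) => k k3.
have lk : 0 < lam k - lam 2%N by rewrite subr_gt0 lam_incr.
have : (\sum_(3 <= j < k.+1) ((lam j - lam 2%N) * `|eigproj j u| ^+ 2)%:E
    <= (excess u)%:E)%E.
  rewrite excess_series//; apply: nneseries_lim_ge => j j3 _.
  exact: excess_terms_ge0.
rewrite T0 big_nat_recr//= => le0.
have : (((lam k - lam 2%N) * `|eigproj k u| ^+ 2)%:E <= 0)%E.
  apply: le_trans le0; rewrite leeDr// big_nat_cond; apply: sume_ge0 => j.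
  by rewrite andbT => /andP[j3 _]; exact: excess_terms_ge0.
rewrite lee_fin pmulr_rle0// => ek; apply/eqP.
by rewrite -norm_sqr_eq0 eq_le ek exprn_ge0.
Qed.

(** Any eigenvector for [lam 2] is orthogonal to the first two eigenspaces and
    has no excess. *)
Lemma extremal_exists : exists u, [/\ form_dom A u, excess u = 0,
  0 < dist2_sq (eigsum A lam 1) u & 0 < distE_sq A (eigsum A lam 1) u].
Proof.
have [u Eu u0] := lam_eigvalue 2; have Du : form_dom A u.
  by apply: form_dom_op; case: Eu.
have T0 : excess u = 0.
  apply/(excess_eq0 Du)/(eigsumP _ Du) => k k2; apply: eigproj_orth Eu _.
  by rewrite ltn_eqF.
have p0 : eigproj 0 u = 0 by exact: eigproj_orth Eu _.
have p1 : eigproj 1 u = 0 by exact: eigproj_orth Eu _.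
have u2 : 0 < `|u| ^+ 2 by rewrite exprn_gt0// normr_gt0.
have lam2 : 0 < lam 2%N by rewrite -lam0 lam_incr.
exists u; split=> //.
  by rewrite dist2_eigsum !big_ord_recl big_ord0 /= p0 p1 normr0 expr0n/= !addr0 subr0.
rewrite distE_eigsum// /eigform !big_ord_recl big_ord0 /= p0 p1 normr0 expr0n/=.
move: T0; rewrite /excess p0 p1 normr0 expr0n/= !mulr0 !addr0 subr0.
by move/eqP; rewrite subr_eq0 => /eqP ->; exact: mulr_gt0.
Qed.

End Spectral.

Unset Implicit Arguments.
Set Strict Implicit.
Set Printing Implicit Defensive.

Theorem theorem2p2 (d : measure_display) (X : measurableType d) (R : realType)
  (mu : {finite_measure set X -> \bar R}) (A : operator mu)
  (A_self_adjoint : self_adjoint A)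
  (A_nonnegative : nonnegative A)
  (A_compact_resolvent : has_compact_resolvent A)
  (lam : nat -> R)
  (lam0 : lam 0%N = 0)
  (lam_increasing : forall i j : nat, (i < j)%N -> lam i < lam j)
  (lam_infty : lam @ \oo --> +oo)
  (lam_eigvalues : [set l | eigvalue A l] = range lam)
  (E0_constants : eigspace A (lam 0%N) =
     [set u | exists c : R, ae_eq mu setT (L2_fun u) (cst c)]) :
  let E k := eigspace A (lam k) in
  let M m := eigsum A lam m in
  let D := form_dom A in
  let delta := deficit A lam in
  let c1 := lam 2%N - lam 1%N in
  let c2 := 1 - lam 1%N / lam 2%N in
  [/\ (* (I) and (II) *)
      forall u, D u -> c1 * dist2_sq (M 1%N) u <= delta u /\
                       c2 * distE_sq A (M 1%N) u <= delta u,
      (* no larger constant is admissible *)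
      (forall c, (forall u, D u -> c * dist2_sq (M 1%N) u <= delta u) ->
         c <= c1) /\
      (forall c, (forall u, D u -> c * distE_sq A (M 1%N) u <= delta u) ->
         c <= c2),
      (* equality is attained at positive distance *)
      (exists u, [/\ D u, dist2_sq (M 1%N) u != 0 &
                     delta u = c1 * dist2_sq (M 1%N) u]) /\
      (exists u, [/\ D u, distE_sq A (M 1%N) u != 0 &
                     delta u = c2 * distE_sq A (M 1%N) u]),
      (* equality cases *)
      forall u, D u ->
        (delta u = c1 * dist2_sq (M 1%N) u <-> M 2%N u) /\
        (delta u = c2 * distE_sq A (M 1%N) u <-> M 2%N u) &
      (* exact remainders *)
      forall u, D u ->
        (delta u - c1 * dist2_sq (M 1%N) u)%:E =
          (\sum_(3 <= k <oo) ((lam k - lam 2%N) * `|oproj (E k) u| ^+ 2)%:E)%E /\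
        (delta u - c2 * distE_sq A (M 1%N) u)%:E =
          ((lam 1%N / lam 2%N)%:E *
           \sum_(3 <= k <oo) ((lam k - lam 2%N) * `|oproj (E k) u| ^+ 2)%:E)%E].
Proof.
move=> E M D delta c1 c2.
have [z [B [AB Bcpt]]] := A_compact_resolvent.
have lam2 : 0 < lam 2%N by rewrite -lam0 lam_increasing.
have lam1 : 0 < lam 1%N by rewrite -lam0 lam_increasing.
have r0 : 0 < lam 1%N / lam 2%N by rewrite divr_gt0.
pose T := excess A lam.
have T2 u : D u -> delta u = c1 * dist2_sq (M 1%N) u + T u.
  by move=> _; apply: (deficit_dist2 A_self_adjoint AB).
have TE u : D u -> delta u = c2 * distE_sq A (M 1%N) u + lam 1%N / lam 2%N * T u.
  by apply: (deficit_distE A_self_adjoint A_nonnegative AB).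
have T_ge0 u : D u -> 0 <= T u.
  by apply: (excess_ge0 A_self_adjoint A_nonnegative AB).
have T_eq0 u : D u -> T u = 0 <-> M 2%N u.
  by apply: (excess_eq0 A_self_adjoint A_nonnegative AB).
have T_series u : D u -> (T u)%:E =
    (\sum_(3 <= k <oo) ((lam k - lam 2%N) * `|oproj (E k) u| ^+ 2)%:E)%E.
  by apply: (excess_series A_self_adjoint A_nonnegative AB).
have sub_of_excess (a b c : R) : a = b + c -> a - b = c by move=> ->; ring.
have eq_of_excess (a b c : R) : a = b + c -> a = b <-> c = 0.
  move=> ->; split=> [|->]; last by rewrite addr0.
  by rewrite -[RHS]addr0 => /addrI.
have pmul_eq0 (r c : R) : 0 < r -> r * c = 0 <-> c = 0.
  move=> r_gt0; split=> [/eqP|->]; last by rewrite mulr0.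
  by rewrite mulf_eq0 gt_eqF// => /eqP.
have [e [De Te d2e dEe]] :=
  extremal_exists A_self_adjoint A_nonnegative AB Bcpt lam0 lam_increasing
    lam_infty lam_eigvalues.
have d2eE : delta e = c1 * dist2_sq (M 1%N) e by rewrite T2// /T Te addr0.
have dEeE : delta e = c2 * distE_sq A (M 1%N) e by rewrite TE// /T Te mulr0 addr0.
split.
- move=> u Du; split; first by rewrite T2// lerDl T_ge0.
  by rewrite TE// lerDl mulr_ge0 ?T_ge0// ltW.
- split=> c /(_ e De); first by rewrite d2eE ler_pM2r.
  by rewrite dEeE ler_pM2r.
- by split; exists e; split=> //; rewrite gt_eqF.
- move=> u Du; split.
    exact: iff_trans (eq_of_excess _ _ _ (T2 u Du)) (T_eq0 u Du).
  apply: iff_trans (eq_of_excess _ _ _ (TE u Du)) _.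
  exact: iff_trans (pmul_eq0 _ _ r0) (T_eq0 u Du).
- move=> u Du; rewrite -(T_series u Du) -EFinM.
  split; congr EFin; first exact: (sub_of_excess _ _ _ (T2 u Du)).
  exact: (sub_of_excess _ _ _ (TE u Du)).
Qed.
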